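(* Let $G$ be a $2$-edge-connected graph of order $n \ge 3$. Then every edge of the basis graph $\operatorname{BG}(M_G)$ is contained in at least $2^{n-3}$ distinct Hamiltonian cycles of $\operatorname{BG}(M_G)$.
   Context: Graphs are finite and without loops; parallel edges are allowed. For such a graph $G$, the cycle matroid $M_G$ has ground set $E(G)$, and its bases are the edge sets of the spanning trees of $G$. For a matroid $M$, its basis graph $\operatorname{BG}(M)$ is the graph whose vertices are the bases of $M$, where two bases $B, B'$ are adjacent if and only if $|B \triangle B'| = 2$. *)

(* Defs.v *)
From HB Require Import structures.
From mathcomp Require Import all_boot.

Set Implicit Arguments.
Unset Strict Implicit.
Unset Printing Implicit Defensive.

(* Edges form a type of their own, so parallel edges are allowed. *)
Record graph := Graph {
  vertex : finType;
  edge : finType;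
  ends : edge -> {set vertex};
  card_ends : forall e, #|ends e| = 2 }.

Section GraphTheory.
Variable G : graph.
Implicit Types (A B : {set edge G}) (x y : vertex G) (e : edge G).

Definition adjacent A : rel (vertex G) :=
  fun x y => [exists e in A, ends e == [set x; y]].

(* The spanning subgraph with edge set A is connected. *)
Definition connected A := [forall x, forall y, connect (adjacent A) x y].

Definition edge_connected k :=
  (1 < #|vertex G|) && [forall F : {set edge G}, (#|F| < k) ==> connected (~: F)].

Definition step : rel (vertex G * edge G) :=
  fun p q => ends p.2 == [set p.1; q.1].

(* A cycle v0 e0 v1 e1 ... is listed as the pairs (v0, e0), (v1, e1), ...  A
   single pair is excluded by card_ends, and two pairs form a cycle only for
   two parallel edges. *)
Definition is_cycle (c : seq (vertex G * edge G)) :=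
  [&& c != [::], cycle step c, uniq (unzip1 c) & uniq (unzip2 c)].

(* The length bound is harmless (acyclicP): a cycle repeats no vertex. *)
Definition acyclic A :=
  [forall k : 'I_#|vertex G|.+1, forall c : k.-tuple (vertex G * edge G),
     is_cycle c ==> ~~ all (mem A) (unzip2 c)].

Definition spanning_trees : {set {set edge G}} :=
  [set A | connected A && acyclic A].

Definition is_hamiltonian_cycle (c : seq (vertex G * edge G)) :=
  is_cycle c && [forall x, x \in unzip1 c].

(* Hamiltonian cycles as subgraphs, i.e. as edge sets, so that the starting
   point and the direction of traversal do not matter. *)
Definition hamiltonian_cycles : {set {set edge G}} :=
  [set C | [exists c : #|vertex G|.-tuple (vertex G * edge G),
     is_hamiltonian_cycle c && (C == [set e in unzip2 c])]].

Lemma acyclicP A :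
  reflect (forall c, is_cycle c -> ~~ all (mem A) (unzip2 c)) (acyclic A).
Proof.
apply: (iffP forallP) => [H c cc | H k].
  have sz : size c < #|vertex G|.+1.
    case/and4P: cc => _ _ u _.
    by rewrite ltnS -(size_map fst) -(card_uniqP u) max_card.
  by have /forallP/(_ (in_tuple c))/implyP := H (Ordinal sz); apply.
by apply/forallP=> c; apply/implyP/H.
Qed.

Lemma hamiltonian_cyclesP (C : {set edge G}) :
  reflect (exists2 c, is_hamiltonian_cycle c & C = [set e in unzip2 c])
          (C \in hamiltonian_cycles).
Proof.
rewrite inE; apply: (iffP existsP) => [[c /andP[h /eqP->]]|[c h ->]].
  by exists c.
have /eqP sz : size c = #|vertex G|.
  case/andP: h => /and4P[_ _ u _] /forallP al.
  rewrite -(size_map fst) -(card_uniqP u); apply: eq_card => x.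
  by rewrite !inE al.
by exists (Tuple sz); rewrite h /=.
Qed.

Lemma edge_connectedS k : edge_connected k.+1 -> connected [set: edge G].
Proof.
by case/andP=> _ /forallP/(_ set0); rewrite cards0 setC0.
Qed.

Lemma adjacent_sym A : symmetric (adjacent A).
Proof. by move=> x y; apply: eq_existsb => e; rewrite setUC. Qed.

Lemma connectC A : connect_sym (adjacent A).
Proof. exact/sym_connect_sym/adjacent_sym. Qed.

Lemma connectW A B : A \subset B ->
  subrel (connect (adjacent A)) (connect (adjacent B)).
Proof.
move=> sAB; apply: connect_sub => x y /existsP[e /andP[eA E]].
by apply/connect1/existsP; exists e; rewrite (subsetP sAB).
Qed.

Lemma set2_inj (T : finType) (a b u v : T) :
  [set a; b] = [set u; v] -> (a = u /\ b = v) \/ (a = v /\ b = u).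
Proof.
move=> E.
have ha : a \in [set u; v] by rewrite -E set21.
have hb : b \in [set u; v] by rewrite -E set22.
have hu : u \in [set a; b] by rewrite E set21.
have hv : v \in [set a; b] by rewrite E set22.
case/set2P: ha => ?; case/set2P: hb => ?; case/set2P: hu => ?;
  case/set2P: hv => ?; subst; by [left | right].
Qed.

Lemma connect_del A f u v x y : ends f = [set u; v] ->
  connect (adjacent A) x y ->
  [\/ connect (adjacent (A :\ f)) x y,
      connect (adjacent (A :\ f)) x u /\ connect (adjacent (A :\ f)) v y |
      connect (adjacent (A :\ f)) x v /\ connect (adjacent (A :\ f)) u y].
Proof.
move=> Ef /connectP[p]; elim: p x => [|z p IH] x /=.
  by move=> _ ->; constructor 1.
move=> /andP[/existsP[g /andP[gA /eqP Eg]] pz] Ey.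
have [gf|gf] := eqVneq g f.
  subst g; move: Eg; rewrite Ef => /esym/set2_inj[[-> ?]|[-> ?]]; subst z.
    case: (IH _ pz Ey) => [c|[_ c]|[_ c]].
    - by constructor 2.
    - by constructor 2.
    - by constructor 1.
  case: (IH _ pz Ey) => [c|[_ c]|[_ c]].
  - by constructor 3.
  - by constructor 1.
  - by constructor 3.
have xz : connect (adjacent (A :\ f)) x z.
  by apply/connect1/existsP; exists g; rewrite !inE gf gA Eg eqxx.
case: (IH _ pz Ey) => [c|[c d]|[c d]].
- by constructor 1; apply: connect_trans c.
- by constructor 2; split=> //; apply: connect_trans c.
- by constructor 3; split=> //; apply: connect_trans c.
Qed.

Lemma connect_cross A (S : {set vertex G}) x y :
  connect (adjacent A) x y -> x \in S -> y \notin S ->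
  exists f u v, [/\ f \in A, ends f = [set u; v], u \in S & v \notin S].
Proof.
case/connectP=> p; elim: p x => [|z p IH] x /=; first by move=> _ -> ->.
move=> /andP[/existsP[g /andP[gA /eqP Eg]] pz] Ey xS yS.
have [zS|zS] := boolP (z \in S); first exact: IH pz Ey zS yS.
by exists g, x, z.
Qed.

Lemma path_step_connect A z t w : path step z (rcons t w) ->
  {subset z.2 :: unzip2 t <= A} -> connect (adjacent A) z.1 w.1.
Proof.
elim: t z => [|z' t IH] z /= /andP[st pt] sA.
  by apply/connect1/existsP; exists z.2; rewrite sA ?mem_head.
apply: (@connect_trans _ _ z'.1).
  by apply/connect1/existsP; exists z.2; rewrite sA ?mem_head.
by apply: IH => // e eI; apply: sA; rewrite inE eI orbT.
Qed.

Lemma path_lift A x p : path (adjacent A) x p -> uniq (x :: p) ->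
  exists c : seq (vertex G * edge G),
  [/\ unzip1 c = belast x p, {subset unzip2 c <= A}, uniq (unzip2 c),
      (forall f, f \in unzip2 c -> {subset ends f <= x :: p}) &
      forall p0 e0, ends p0.2 = [set p0.1; x] ->
        path step p0 (rcons c (last x p, e0))].
Proof.
elim: p x => [|y p IH] x /=.
  by exists [::]; split=> // p0 e0 E /=; rewrite /step E eqxx.
move=> /andP[/existsP[f /andP[fA /eqP Ef]] py] /andP[xp up].
have [c [E1 s2 u2 se st]] := IH _ py up.
exists ((x, f) :: c); split=> /=.
- by rewrite E1.
- by move=> e; rewrite inE => /orP[/eqP->//|/s2].
- rewrite u2 andbT; apply: contra xp => /se; apply.
  by rewrite Ef set21.
- move=> g; rewrite inE => /orP[/eqP->|/se H] z.
    by rewrite Ef !inE => /orP[]->; rewrite ?orbT.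
  by move=> /H; rewrite [z \in x :: _]inE orbC => ->.
- by move=> p0 e0 E; rewrite /step /= E eqxx /=; apply: st.
Qed.

Lemma acyclic_bridgeP A :
  reflect (forall e x y, e \in A -> ends e = [set x; y] ->
             ~~ connect (adjacent (A :\ e)) x y)
          (acyclic A).
Proof.
apply: (iffP (acyclicP A)) => [ac e x y eA Ee | br c cc].
  apply/negP => /connectP[p0 /shortenP[p pp up _] Ey].
  have [c [E1 s2 u2 _ st]] := path_lift pp up.
  suff /ac/negP[] : is_cycle ((y, e) :: c).
    by apply/allP=> f; rewrite inE => /orP[/eqP->//|/s2 /setD1P[]].
  apply/and4P; split=> //=.
  - by rewrite {2}Ey st // Ee setUC.
  - by rewrite E1 Ey -rcons_uniq -lastI.
  - by rewrite u2 andbT; apply/negP=> /s2; rewrite !inE eqxx.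
apply/negP=> /allP sA; case: c => [|[x e] t] in cc sA *; first by case/and4P: cc.
case/and4P: cc => _ /= ct _ /andP[et _].
case: t => [|[y f] t] in ct sA et *.
  move: ct => /= /andP[/eqP /= E _].
  by have := card_ends e; rewrite E setUid cards1.
move: ct => /= /andP[/eqP /= E pt].
have eA : e \in A by apply: sA; rewrite /= mem_head.
have /negP[] := br _ _ _ eA E.
rewrite connectC; apply: (path_step_connect pt) => g gI.
have gA : g \in A by apply: sA; rewrite /= inE gI orbT.
rewrite in_setD1 gA andbT.
by apply: contraNneq et => <-.
Qed.

Lemma spanning_trees_neq0 : connected [set: edge G] -> spanning_trees != set0.
Proof.
move=> cG; case: (@arg_minnP _ [set: edge G] connected (fun A => #|A|) cG).
move=> A cA minA; apply/set0Pn; exists A; rewrite inE cA.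
apply/acyclic_bridgeP=> e x y eA Ee; apply/negP=> cxy.
have /minA : connected (A :\ e).
  apply/forallP=> a; apply/forallP=> b.
  have /forallP/(_ a)/forallP/(_ b) := cA.
  case/(connect_del Ee) => [//|[c d]|[c d]].
    exact: connect_trans (connect_trans c cxy) d.
  by apply: connect_trans d; apply: connect_trans c _; rewrite connectC.
by rewrite leqNgt (cardsD1 e A) eA ltnS leqnn.
Qed.

Lemma spanning_trees_exchange A B e :
  A \in spanning_trees -> B \in spanning_trees -> e \in A :\: B ->
  exists2 f, f \in B :\: A & f |: (A :\ e) \in spanning_trees.
Proof.
rewrite !inE => /andP[cA aA] /andP[cB aB] /andP[eB eA].
have /eqP/cards2P[x [y [_ Ee]]] := card_ends e.
have nxy := elimT (acyclic_bridgeP A) aA e x y eA Ee.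
pose S := [set z | connect (adjacent (A :\ e)) x z].
have cxy : connect (adjacent B) x y.
  by have /forallP/(_ x)/forallP/(_ y) := cB.
have [||f [u [v [fB Ef uS vS]]]] := connect_cross (S := S) cxy.
- by rewrite inE.
- by rewrite inE.
have fAe : f \notin A :\ e.
  apply: contra vS => fAe; rewrite !inE in uS *; apply: connect_trans uS _.
  by apply/connect1/existsP; exists f; rewrite fAe Ef eqxx.
have fe : f != e by apply: contraNneq eB => <-.
have fA : f \notin A by apply: contra fAe; rewrite !inE fe.
exists f; rewrite ?inE ?fA ?fB //.
have sub : A :\ e \subset f |: (A :\ e) by apply: subsetUr.
rewrite !inE in uS vS.
have xoy z : connect (adjacent (A :\ e)) x z \/ connect (adjacent (A :\ e)) y z.
  have /forallP/(_ x)/forallP/(_ z) := cA.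
  by case/(connect_del Ee) => [?|[_ ?]|[_ ?]]; [left|right|left].
have yv : connect (adjacent (A :\ e)) y v by case: (xoy v) => // H; rewrite H in vS.
apply/andP; split.
  have xy : connect (adjacent (f |: A :\ e)) x y.
    apply: connect_trans (connectW sub uS) _.
    apply: (@connect_trans _ _ v); last by rewrite connectC (connectW sub yv).
    by apply/connect1/existsP; exists f; rewrite !inE eqxx Ef /=.
  have xz z : connect (adjacent (f |: A :\ e)) x z.
    case: (xoy z) => /(connectW sub) //; exact: connect_trans xy.
  apply/forallP=> a; apply/forallP=> b.
  by apply: connect_trans (xz b); rewrite connectC.
apply/acyclic_bridgeP=> g a b; rewrite in_setU1 => /orP[/eqP->|gAe] Eg.
  rewrite setU1K //; have {Eg} := etrans (esym Eg) Ef.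
  move=> /set2_inj[[-> ->]|[-> ->]]; apply: contra vS => H.
    exact: connect_trans uS H.
  by apply: connect_trans uS _; rewrite connectC.
have [ge gA] := setD1P gAe.
apply/negP=> /(connect_del Ef).
have -> : (f |: A :\ e) :\ g :\ f = A :\ e :\ g.
  by rewrite setDDl [[set g] :|: _]setUC -setDDl setU1K.
have sub2 := connectW (subsetDl (A :\ e) [set g]).
have ab : connect (adjacent (A :\ e)) a b.
  by apply/connect1/existsP; exists g; rewrite gAe Eg eqxx.
case=> [|[/sub2 au /sub2 vb]|[/sub2 av /sub2 ub]].
- have sub3 : A :\ e :\ g \subset A :\ g by apply/setSD/subsetDl.
  by move/(connectW sub3); apply/negP; apply: (elimT (acyclic_bridgeP A)).
- case/negP: vS; apply: connect_trans uS _; rewrite connectC in au.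
  by apply: connect_trans au _; apply: connect_trans ab _; rewrite connectC.
- case/negP: vS; apply: connect_trans uS _; apply: connect_trans ub _.
  by rewrite connectC in ab; apply: connect_trans ab _.
Qed.

End GraphTheory.

Arguments edge_connected : clear implicits.
Arguments connected {G} A.
Arguments spanning_trees : clear implicits.
Arguments hamiltonian_cycles : clear implicits.

Record matroid (E : finType) := Matroid {
  bases : {set {set E}};
  bases_neq0 : bases != set0;
  bases_exchange : forall B B' x,
    B \in bases -> B' \in bases -> x \in B :\: B' ->
    exists2 y, y \in B' :\: B & y |: (B :\ x) \in bases }.

Definition cycle_matroid (G : graph) (conn : connected [set: edge G]) :
    matroid (edge G) :=
  Matroid (spanning_trees_neq0 conn) (@spanning_trees_exchange G).

Definition symdiff (E : finType) (A B : {set E}) := (A :\: B) :|: (B :\: A).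

Section BasisGraph.
Variables (E : finType) (M : matroid E).

Definition basis := {B : {set E} | B \in bases M}.

Definition basis_adjacent : rel basis :=
  fun B B' => #|symdiff (val B) (val B')| == 2.

Definition basis_edge :=
  {P : {set basis} |
    [exists B, exists B', basis_adjacent B B' && (P == [set B; B'])]}.

Lemma card_basis_edge (e : basis_edge) : #|val e| = 2.
Proof.
case: e => P /= /existsP[B /existsP[B' /andP[adj /eqP->]]].
rewrite cards2; case: eqVneq => // BB'; move: adj.
by rewrite BB' /basis_adjacent /symdiff setDv setU0 cards0.
Qed.

Definition basis_graph := Graph card_basis_edge.

End BasisGraph.

(* Main.v *)
Require Import Defs.
From mathcomp Require Import all_boot.

(* Only two facts about M_G matter: it has no coloops and rank n - 1.  For
   adjacent bases X and Y = X - a + b of a matroid, let m be the number of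
   noncoloops in X :&: Y.  By induction on m, there are at least 2 ^ (m - 1)
   Hamiltonian paths from X to Y; closing them up gives the cycles through XY.

   Call a noncoloop c of X :&: Y bad if {b, c} and {a, c} are both cocircuits.
   If no c is bad, split the basis graph into the bases with and without a.
   Each c yields a square X X1 Y1 Y with X1 = X - c + d on the side of X, and
   Hamiltonian paths X -> X1 and Y1 -> Y of the two sides join up; two
   different c double the count.  If some c is bad, split at c instead.  Take
   a Hamiltonian path from X to Y in the side containing c, and insert a
   Hamiltonian path of the other side at one of its edges.  This is possible
   at every edge if the other side is a single basis.  Otherwise X and Y have
   the same unique neighbour U there, while some basis of the path has another
   neighbour: so along the path the property "U is the only neighbour" is lost
   and regained, and at both places an insertion exists. *)

Set Implicit Arguments.
Unset Strict Implicit.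
Unset Printing Implicit Defensive.

(** * Exchange families and their minors *)

Section SetFamilies.
Variable E : finType.
Implicit Types (F : {set {set E}}) (X Y P Q R U V W : {set E}) (p q : seq {set E}).

Definition exchange F := forall B B' x, B \in F -> B' \in F ->
  x \in B :\: B' -> exists2 y, y \in B' :\: B & y |: (B :\ x) \in F.

Definition swap X c d := d |: (X :\ c).

Definition adj : rel {set E} :=
  fun X Y => [exists c in X, exists d in ~: X, Y == swap X c d].

(* The contraction and the deletion of e keep the ground set, so that their
   basis graphs are induced subgraphs. *)
Definition con F e := [set B in F | e \in B].
Definition del F e := [set B in F | e \notin B].

Definition coloops F := \bigcap_(B in F) B.

Lemma adjP X Y :
  reflect (exists c d, [/\ c \in X, d \notin X & Y = swap X c d]) (adj X Y).
Proof.
apply: (iffP existsP) => [[c /andP[cX /existsP[d /andP[dX /eqP->]]]]|].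
  by exists c, d; split=> //; rewrite inE in dX.
case=> c [d [cX dX ->]]; exists c; rewrite cX; apply/existsP; exists d.
by rewrite inE dX eqxx.
Qed.

Lemma adj_swap X c d : c \in X -> d \notin X -> adj X (swap X c d).
Proof. by move=> cX dX; apply/adjP; exists c, d. Qed.

Ltac mem_cases :=
  repeat match goal with |- context [?u == ?v] =>
    case: (eqVneq u v) => [?|?]; subst; rewrite ?eqxx /= end;
  repeat match goal with
    | H : is_true (?x != ?x) |- _ => by rewrite eqxx in H
    | H : is_true (?x \in ?X), K : is_true (?x \notin ?X) |- _ =>
        by rewrite H in K
    | H : is_true (_ \in _) |- _ => rewrite ?H; clear H
    | H : is_true (_ \notin _) |- _ => rewrite ?(negPf H); clear H
    end; rewrite ?andbT ?andbF ?orbT ?orbF //.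

Ltac swap_eq := rewrite /swap; apply/setP=> z; rewrite !inE; mem_cases.

Lemma swapK X c d : c \in X -> d \notin X -> swap (swap X c d) d c = X.
Proof. by move=> cX dX; swap_eq. Qed.

Lemma mem_swapl X c d : c \in X -> d \notin X -> c \notin swap X c d.
Proof. by move=> cX dX; rewrite !inE; mem_cases. Qed.

Lemma mem_swapr X c d : d \in swap X c d.
Proof. by rewrite !inE eqxx. Qed.

Lemma setI_swap X c d : d \notin X -> X :&: swap X c d = X :\ c.
Proof. by move=> dX; swap_eq; case: (_ \in X); rewrite ?andbF. Qed.

Lemma adj_sym : symmetric adj.
Proof.
have H X Y : adj X Y -> adj Y X.
  case/adjP=> c [d [cX dX ->]]; apply/adjP; exists d, c.
  by rewrite mem_swapr mem_swapl ?swapK.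
by move=> X Y; apply/idP/idP; apply: H.
Qed.

Lemma exchange_con F e : exchange F -> exchange (con F e).
Proof.
move=> exF B B' x; rewrite !inE => /andP[BF eB] /andP[B'F eB'] xBB'.
have [|y yB yF] := exF _ _ x BF B'F; first by rewrite inE.
exists y => //; rewrite !inE yF eB andbT /=.
by case: (eqVneq e x) xBB' => [<-|]; rewrite ?eB' ?orbT.
Qed.

Lemma exchange_del F e : exchange F -> exchange (del F e).
Proof.
move=> exF B B' x; rewrite !inE => /andP[BF eB] /andP[B'F eB'] xBB'.
have [|y yB yF] := exF _ _ x BF B'F; first by rewrite inE.
exists y => //; rewrite !inE yF (negPf eB) andbF orbF /=.
by move: yB; rewrite inE => /andP[_]; apply: contraL => /eqP <-.
Qed.

(** An element of [B] outside [A] would have to be exchanged for an element of [A :\: B], which is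
    empty. *)
Lemma exchange_antichain F A B : exchange F -> A \in F -> B \in F ->
  A \subset B -> A = B.
Proof.
move=> exF AF BF sAB; apply/eqP; rewrite eqEsubset sAB; apply/subsetP=> x xB.
apply: contraT => xA; have [|y] := exF _ _ x BF AF; first by rewrite inE xA xB.
by rewrite inE => /andP[yB /(subsetP sAB)]; rewrite (negPf yB).
Qed.

(* Moving B' towards B one exchange at a time, while keeping x. *)
Lemma exchange_dual F B B' x : exchange F -> B \in F -> B' \in F ->
  x \in B' :\: B -> exists2 y, y \in B :\: B' & swap B y x \in F.
Proof.
move=> exF BF B'F; rewrite inE => /andP[xB xB'].
have: B :&: B' \subset B' by apply: subsetIr.
(* The moving basis [D] starts at [B'] and always keeps [x] and [B :&: B']; [B'] itself stays fixed
   in the conclusion. *)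
move: {1 2 4}B' B'F xB' => D; have [n] := ubnP #|D :\: B|; elim: n => // n IH in D *.
rewrite ltnS => le DF xD sD.
(* If [x] is the only element of [D] outside [B], exchanging it for some [y] gives a basis inside
   [B], hence [B] itself, so [D] is the required swap. Otherwise another element [z] is exchanged
   first. *)
have [Dx|[z]] := set_0Vmem ((D :\: B) :\ x).
  have [|y] := exF _ _ x DF BF; first by rewrite inE xB xD.
  rewrite inE => /andP[yD yB] yF.
  exists y.
    rewrite inE yB andbT; apply: contra yD => yB'.
    by apply: (subsetP sD); rewrite inE yB yB'.
  have eB : y |: (D :\ x) = B.
    apply: (exchange_antichain exF) => //; apply/subsetP=> z.
    rewrite !inE => /orP[/eqP->//|/andP[zx zD]]; apply: contraT => zB.
    by have := in_set0 z; rewrite -Dx in_setD1 in_setD zx zB zD.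
  suff -> : swap B y x = D by [].
  by rewrite -eB -[RHS](@swapK _ x y).
rewrite !inE => /and3P[zx zB zD].
have [|y] := exF _ _ z DF BF; first by rewrite inE zB zD.
rewrite inE => /andP[yD yB] yF.
apply: (IH _ _ yF); last 2 first.
- by rewrite !inE [x == z]eq_sym zx xD orbT.
- apply/subsetP=> t tI; rewrite !inE (subsetP sD) // andbT.
  by rewrite orbC (contraTneq _ tI) // => ->; rewrite inE (negPf zB).
apply: leq_trans le; apply: proper_card; apply/properP; split.
  apply/subsetP=> t; rewrite !inE => /andP[tB /orP[/eqP ty|/andP[_ ->]]].
    by rewrite ty yB in tB.
  by rewrite tB.
exists z; rewrite !inE ?zB ?zD // eqxx /= orbF.
by apply/negP => /eqP zy; rewrite zy yB in zB.
Qed.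

(** The two differences have total size 2. If one were empty, the antichain property would make [X]
    and [Y] equal; so each is a singleton. *)
Lemma adj_symdiff F X Y : exchange F -> X \in F -> Y \in F ->
  #|symdiff X Y| = 2 -> adj X Y.
Proof.
move=> exF XF YF; rewrite /symdiff cardsU.
rewrite (_ : (X :\: Y) :&: _ = set0) ?cards0 ?subn0; last first.
  by apply/setP=> z; rewrite !inE; case: (z \in X); case: (z \in Y).
have nz A B : A \in F -> B \in F -> #|A :\: B| = 0 -> A = B.
  move=> AF BF /eqP; rewrite cards_eq0 setD_eq0; exact: exchange_antichain exF AF BF.
case nX: #|X :\: Y| => [|[|[|k]]] //.
- by rewrite (nz _ _ XF YF nX) setDv cards0.
- case=> nY; have /eqP/cards1P[a Ea] := nX; have /eqP/cards1P[b Eb] := nY.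
  apply/adjP; exists a, b.
  have := set11 a; rewrite -{1}Ea inE => /andP[aY aX].
  have := set11 b; rewrite -{1}Eb inE => /andP[bX bY].
  split=> //; apply/setP=> z; rewrite !inE.
  have := in_set1 z a; rewrite -{1}Ea inE => <-.
  have := in_set1 z b; rewrite -{1}Eb inE => <-.
  by case: (z \in X); case: (z \in Y).
- case=> nY; move: nX; rewrite (nz _ _ YF XF) ?setDv ?cards0 //.
Qed.

(** * Coloops, single exchanges and squares *)

Lemma coloops_avoid F c : c \notin coloops F -> exists2 B, B \in F & c \notin B.
Proof.
move=> H; have /exists_inP[B BF cB] : [exists B in F, c \notin B]; last by exists B.
apply: contraR H => /exists_inPn H; apply/bigcapP=> B /H.
by rewrite negbK.
Qed.

(** A basis avoiding [c] acquires [e] by a dual exchange without acquiring [c], so it yields a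
    witness in the contraction. *)
Lemma coloops_con F X e : exchange F -> X \in F -> e \in X ->
  coloops (con F e) \subset e |: coloops F.
Proof.
move=> exF XF eX; apply/subsetP=> c /bigcapP cc; apply: contraT.
rewrite !inE negb_or => /andP[ce /coloops_avoid[B BF cB]].
have [eB|eB] := boolP (e \in B).
  by have := cc B; rewrite inE BF eB (negPf cB) => ->.
have [|y yB yF] := exchange_dual (x := e) exF BF XF; first by rewrite inE eB eX.
have := cc (swap B y e); rewrite inE yF mem_swapr => /(_ isT).
by rewrite !inE (negPf ce) (negPf cB) andbF.
Qed.

Lemma noncoloop_swap F X c : exchange F -> X \in F -> c \in X ->
  c \notin coloops F -> exists2 d, d \notin X & swap X c d \in F.
Proof.
move=> exF XF cX /coloops_avoid[B BF cB].
have [|y] := exF _ _ c XF BF; first by rewrite inE cB cX.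
by rewrite inE => /andP[yX _] yF; exists y.
Qed.

Lemma card_ge2_swap F X : exchange F -> X \in F -> F != [set X] ->
  exists c d, [/\ c \in X, d \notin X & swap X c d \in F].
Proof.
move=> exF XF nF.
have [Y YF YX] : exists2 Y, Y \in F & Y != X.
  apply/exists_inP; apply: contraR nF => /exists_inPn H.
  apply/eqP/setP=> Y; rewrite inE; apply/idP/eqP => [/H|->//].
  by rewrite negbK => /eqP.
have [c] : exists c, c \in X :\: Y.
  apply/set0Pn; apply: contra YX; rewrite setD_eq0 => s.
  by rewrite (exchange_antichain exF XF YF s).
rewrite inE => /andP[cY cX]; have [|d] := exF _ _ c XF YF; first by rewrite inE cY cX.
by rewrite inE => /andP[dX _] dF; exists c, d.
Qed.

(** For a basis [X] containing [c]: the fundamental cocircuit of [c] lies in [{b, c}]. *)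
Definition only F X c b := [forall d, (d \notin X) && (swap X c d \in F) ==> (d == b)].

Lemma onlyP F X c b :
  reflect (forall d, d \notin X -> swap X c d \in F -> d = b) (only F X c b).
Proof.
apply: (iffP forallP) => H d; first by move=> dX dF; apply/eqP; have := H d; rewrite dX dF.
by apply/implyP => /andP[dX dF]; apply/eqP/H.
Qed.

Lemma onlyPn F X c b :
  ~~ only F X c b -> exists d, [/\ d \notin X, d != b & swap X c d \in F].
Proof.
by case/forallPn=> d; rewrite negb_imply => /andP[/andP[dX dF] db]; exists d.
Qed.

(* Y = swap X a b; for a noncoloop c this says that a, b and c are in series. *)
Definition bad F X a b c := only F X c b && only F (swap X a b) c a.

(** Since [c] is not bad, there is a basis [X - c + d] with [d] other than [b], or a basis
    [Y - c + d] with [d] other than [a]. One more exchange completes the square. *)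
Lemma square F X a b c : exchange F -> X \in F -> swap X a b \in F ->
  a \in X -> b \notin X -> c \in X -> c != a -> ~~ bad F X a b c ->
  exists d Y', [/\ d \notin X, swap X c d \in con F a, Y' \in del F a,
    adj (swap X c d) Y' & adj Y' (swap X a b)].
Proof.
move=> exF XF YF aX bX cX ca; set Y := swap X a b in YF *.
have ab : a != b by apply: contraNneq bX => <-.
have cb : c != b by apply: contraNneq bX => <-.
have inC d : d \notin X -> swap X c d \in F -> swap X c d \in con F a.
  by move=> dX H; rewrite inE H !inE aX andbT [a == c]eq_sym ca orbT.
rewrite negb_and => /orP[/onlyPn[d [dX db dF]]|/onlyPn[d [dY da dF]]].
  have cd : c != d by apply: contraNneq dX => <-.
  have ad : a != d by apply: contraNneq dX => <-.
  (* Bringing [d] into [Y] from [X - c + d] can expel only [c] or [b]; either result is adjacent to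
     both corners. *)
  have [|y yI yF] := exchange_dual (x := d) exF YF dF.
    by rewrite !inE eqxx (negPf db) (negPf dX) andbF.
  have y_cb : y = c \/ y = b.
    move: yI; rewrite !inE; case: (y =P b); case: (y =P c); auto.
    by case: (y =P a); case: (y \in X); rewrite ?orbT ?andbF.
  exists d, (swap Y y d); split=> //; first exact: inC.
  - rewrite inE yF !inE (negPf ad) eqxx (negPf ab) /=; by rewrite andbF.
  - case: y_cb => ->; last first.
      apply/adjP; exists a, c; split; first by rewrite !inE; mem_cases.
        exact: mem_swapl.
      by rewrite /Y; swap_eq.
    apply/adjP; exists a, b; split; first by rewrite !inE; mem_cases.
      by rewrite !inE; mem_cases.
    by rewrite /Y; swap_eq.
  - rewrite adj_sym; apply: adj_swap; first by case/setDP: yI.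
    by rewrite !inE (negPf db) (negPf dX) andbF.
have db : d != b by apply: contraNneq dY => ->; rewrite mem_swapr.
have dX : d \notin X by apply: contra dY => dX; rewrite !inE dX da orbT.
have cd : c != d by apply: contraNneq dX => <-.
(* Now [Y - c + d] is the corner next to [Y]. Exchanging [c] out of [X] towards it gives [X - c + y]
   with [y] equal to [d] or [b]. *)
have [|y yI yF] := exF _ _ c XF dF.
  by rewrite !inE eqxx (negPf cd) cX.
have y_db : y = d \/ y = b.
  move: yI; rewrite !inE; case: (y =P b); case: (y =P d); auto.
  by case: (y =P a); case: (y \in X); rewrite ?orbT ?andbF.
have yX : y \notin X by case/setDP: yI.
exists y, (swap Y c d); split=> //.
- exact: inC.
- rewrite inE dF !inE eqxx (negPf ab) eq_sym (negPf da) /=; by rewrite andbF.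
- case: y_db => ->; apply/adjP.
    exists a, b; split; [by rewrite !inE; mem_cases.. | by rewrite /Y; swap_eq].
  exists a, d; split; [by rewrite !inE; mem_cases.. | by rewrite /Y; swap_eq].
- rewrite adj_sym; apply: adj_swap => //.
  by rewrite !inE cX ca orbT.
Qed.

(** * Hamiltonian paths between adjacent bases *)

Definition hampath F X Y p :=
  [&& path adj X p, last X p == Y, uniq (X :: p) & [set z in X :: p] == F].

Lemma mem_hampath F X Y p : hampath F X Y p -> X :: p =i F.
Proof. by case/and4P=> _ _ _ /eqP<- z; rewrite in_set. Qed.

Lemma mem_con F e X : (X \in con F e) = (X \in F) && (e \in X).
Proof. by rewrite inE. Qed.

Lemma mem_del F e X : (X \in del F e) = (X \in F) && (e \notin X).
Proof. by rewrite inE. Qed.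

Lemma hampath1 F X : F = [set X] -> hampath F X X [::].
Proof. by move=> ->; rewrite /hampath /= eqxx; apply/eqP/setP=> z; rewrite !inE. Qed.

Lemma hampath_sides F e s1 s2 :
  s1 =i con F e -> s2 =i del F e -> s1 ++ s2 =i F.
Proof.
move=> E1 E2 z; rewrite mem_cat E1 E2 mem_con mem_del -andb_orr.
by rewrite orbN andbT.
Qed.

Lemma filter_sides F e s1 s2 : {subset s1 <= con F e} -> {subset s2 <= del F e} ->
  [seq B : {set E} <- s1 ++ s2 | e \in B] = s1.
Proof.
move=> E1 E2; rewrite filter_cat (_ : filter _ s2 = [::]) ?cats0.
  by apply/all_filterP/allP=> B /E1; rewrite mem_con => /andP[].
apply/eqP; rewrite -size_eq0 size_filter -leqn0 leqNgt -has_count.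
by apply/hasPn=> B /E2; rewrite mem_del => /andP[].
Qed.

Lemma hampath_cat F e X X1 Y1 Y p q :
  hampath (con F e) X X1 p -> hampath (del F e) Y1 Y q -> adj X1 Y1 ->
  hampath F X Y (p ++ Y1 :: q).
Proof.
move=> hp hq a1; have mp := mem_hampath hp; have mq := mem_hampath hq.
case/and4P: hp => pp /eqP lp up _; case/and4P: hq => pq lq uq _.
apply/and4P; split.
- by rewrite cat_path pp lp /= a1.
- by rewrite last_cat.
- rewrite -cat_cons cat_uniq up uq andbT andTb; apply/hasPn=> z.
  by rewrite mq mem_del mp mem_con => /andP[_ /negPf->]; rewrite andbF.
- by apply/eqP/setP=> z; rewrite in_set -cat_cons (hampath_sides mp mq).
Qed.

Lemma hampath_insert F e X Y P' Q' p1 Q p2 q :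
  hampath (con F e) X Y (p1 ++ Q :: p2) -> hampath (del F e) P' Q' q ->
  adj (last X p1) P' -> adj Q' Q ->
  hampath F X Y (p1 ++ P' :: q ++ Q :: p2).
Proof.
move=> hp hq a1 a2; have mp := mem_hampath hp; have mq := mem_hampath hq.
case/and4P: hp => pp lp up _; case/and4P: hq => pq /eqP lq uq _.
have pe : perm_eq (X :: p1 ++ P' :: q ++ Q :: p2)
                  ((X :: p1 ++ Q :: p2) ++ P' :: q).
  by rewrite -!cat_cons -[in X in perm_eq _ X]catA perm_cat2l perm_catC.
move: pp; rewrite cat_path /= => /and3P[pp1 _ pp2].
apply/and4P; split.
- by rewrite cat_path pp1 /= a1 cat_path pq lq /= a2.
- by move: lp; rewrite !last_cat /= last_cat.
- rewrite (perm_uniq pe) cat_uniq up uq andbT andTb; apply/hasPn=> z.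
  by rewrite mq mem_del mp mem_con => /andP[_ /negPf->]; rewrite andbF.
- by apply/eqP/setP=> z; rewrite in_set (perm_mem pe) (hampath_sides mp mq).
Qed.

(** Induction on the size of [F]: [con F a] misses [Y] and [del F a] misses [X], so both are
    smaller. It remains to find an edge between them whose ends are adjacent to [X] and [Y], or
    equal to them on a one-element side. *)
Lemma hampath_exists F X Y : exchange F -> X \in F -> Y \in F -> adj X Y ->
  exists p, hampath F X Y p.
Proof.
have [n] := ubnP #|F|; elim: n => // n IH in F X Y *.
rewrite ltnS => le exF XF YF /adjP[a [b [aX bX EY]]]; subst Y.
set Y := swap X a b in YF *.
have ab : a != b by apply: contraNneq bX => <-.
have aY : a \notin Y by apply: mem_swapl.
have XC : X \in con F a by rewrite mem_con XF.
have YD : Y \in del F a by rewrite mem_del YF.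
have ltC : #|con F a| < n.
  apply: leq_trans le; apply: proper_card; apply/properP; split.
    by apply/subsetP=> z; rewrite mem_con => /andP[].
  by exists Y => //; rewrite mem_con (negPf aY) andbF.
have ltD : #|del F a| < n.
  apply: leq_trans le; apply: proper_card; apply/properP; split.
    by apply/subsetP=> z; rewrite mem_del => /andP[].
  by exists X => //; rewrite mem_del aX andbF.
have exC := exchange_con (e := a) exF; have exD := exchange_del (e := a) exF.
have glue X1 Y1 : X1 \in con F a -> Y1 \in del F a -> adj X1 Y1 ->
    adj X X1 \/ con F a = [set X] /\ X1 = X ->
    adj Y1 Y \/ del F a = [set Y] /\ Y1 = Y -> exists p, hampath F X Y p.
  move=> X1C Y1D a1 hX hY.
  have [p hp] : exists p, hampath (con F a) X X1 p.
    case: hX => [|[? ->]]; [exact: IH | by exists [::]; apply: hampath1].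
  have [q hq] : exists q, hampath (del F a) Y1 Y q.
    case: hY => [|[? ->]]; [exact: IH | by exists [::]; apply: hampath1].
  by exists (p ++ Y1 :: q); apply: hampath_cat hp hq a1.
have [/exists_inP[c cX /andP[ca nb]]|] :=
    boolP [exists c in X, (c != a) && ~~ bad F X a b c].
  have [d [Y1 [dX X1C Y1D a1 a2]]] := square exF XF YF aX bX cX ca nb.
  by apply: (glue _ Y1 X1C) => //; left; rewrite ?adj_swap.
move/exists_inPn=> allbad.
have bd c : c \in X -> c != a -> bad F X a b c.
  by move=> /allbad; rewrite negb_and !negbK; case: eqP.
(* With every [c] bad, a neighbour of [X] in the contraction has the form [X - c + b], and a
   neighbour of [Y] in the deletion the form [X - a + g]. *)
have nbC : con F a = [set X] \/ exists2 X1, X1 \in con F a &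
    exists c, [/\ c \in X, c != a & X1 = swap X c b].
  have [->|/(card_ge2_swap exC XC)[c [d [cX dX dF]]]] := eqVneq (con F a) [set X].
    by left.
  right; exists (swap X c d) => //; exists c.
  move: dF; rewrite mem_con => /andP[dF aF].
  have ca : c != a by apply: contraTneq aF => ->; apply: mem_swapl.
  split=> //; have /andP[/onlyP o _] := bd c cX ca.
  by rewrite (o d).
have nbD : del F a = [set Y] \/ exists2 Y1, Y1 \in del F a &
    exists2 g, g \notin Y & Y1 = swap X a g /\ g != a.
  have [->|/(card_ge2_swap exD YD)[c [g [cY gY gF]]]] := eqVneq (del F a) [set Y].
    by left.
  right; exists (swap Y c g) => //; exists g => //.
  move: gF; rewrite mem_del => /andP[gF aF].
  have ga : g != a by apply: contraNneq aF => <-; apply: mem_swapr.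
  split=> //; have [->|cb] := eqVneq c b; first by rewrite /Y; swap_eq.
  have ca : c != a by apply: contraNneq aY => <-.
  have cX : c \in X by move: cY; rewrite !inE (negPf cb) ca.
  have /andP[_ /onlyP o] := bd c cX ca.
  by rewrite (o g) ?eqxx in ga.
have aXY : adj X Y by apply: adj_swap.
case: nbC => [eC|[X1 X1C [c [cX ca EX1]]]]; case: nbD => [eD|[Y1 Y1D [g gY [EY1 ga]]]].
- by apply: (glue X Y) => //; right.
- apply: (glue X Y1) => //; [|by right|].
    rewrite EY1; apply: adj_swap => //.
    by apply: contra gY => gX; rewrite !inE gX ga orbT.
  have gX : g \notin X by apply: contra gY => gX; rewrite !inE gX ga orbT.
  have gb : g != b by apply: contraNneq gY => ->; apply: mem_swapr.
  left; rewrite EY1; apply/adjP; exists g, b; rewrite mem_swapr.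
  by split=> //; [rewrite !inE; mem_cases | rewrite /Y; swap_eq].
- apply: (glue X1 Y) => //; [| |by right].
    rewrite EX1; apply/adjP; exists a, c; rewrite mem_swapl //.
    split=> //; first by rewrite !inE aX andbT [a == c]eq_sym ca orbT.
    have cb : c != b by apply: contraNneq bX => <-.
    by rewrite /Y; swap_eq.
  by left; rewrite EX1; apply: adj_swap.
have gX : g \notin X by apply: contra gY => gX; rewrite !inE gX ga orbT.
have gb : g != b by apply: contraNneq gY => ->; apply: mem_swapr.
have cb : c != b by apply: contraNneq bX => <-.
have cg : c != g by apply: contraNneq gX => <-.
move: X1C Y1D; rewrite mem_con mem_del => /andP[X1F _] /andP[Y1F _].
(* Two nontrivial sides are impossible: exchanging [c] out of [X - a + g] towards [X - c + b] gives
   [X - c + g] or [Y - c + g], and either contradicts that [c] is bad. *)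
have [|y] := exF _ _ c Y1F X1F.
  by rewrite EY1 EX1 !inE (negPf cb) eqxx (negPf cg) ca cX.
have /andP[/onlyP oX /onlyP oY] := bd c cX ca.
rewrite EY1 EX1 => yI yF.
have y_ab : y = a \/ y = b.
  move: yI; rewrite !inE; case: (y =P a); case: (y =P b); auto.
  by case: (y =P g); case: (y \in X); rewrite ?orbT ?andbF ?andbT.
case: y_ab yF => ->.
  rewrite (_ : _ |: _ = swap X c g) => [/(oX _ gX) gb'|]; last by swap_eq.
  by rewrite gb' eqxx in gb.
rewrite (_ : _ |: _ = swap Y c g) => [/(oY _ gY) ga'|]; last by rewrite /Y; swap_eq.
by rewrite ga' eqxx in ga.
Qed.

(** * Insertion of a path of the deletion into a path of the contraction *)

Lemma hampath_sub F X Y p : hampath F X Y p -> {subset p <= F}.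
Proof. by move=> h z zp; rewrite -(mem_hampath h) inE zp orbT. Qed.

(** This makes gluing injective in [p]. *)
Lemma filter_hampath_cat F e X X1 Y1 Y p q :
  hampath (con F e) X X1 p -> hampath (del F e) Y1 Y q ->
  [seq B : {set E} <- p ++ Y1 :: q | e \in B] = p.
Proof.
move=> hp hq; apply: (@filter_sides F e); first exact: hampath_sub hp.
by move=> z; rewrite (mem_hampath hq).
Qed.

(** Here the split is at [c]: [X] and [Y] lie on one side, the opposite edge of the square on the
    other. Bringing [b] into [X - c + d] from [Y] expels [a] or [d], and both results are neighbours
    of [Y]. *)
Lemma square_del F X a b c d : exchange F -> swap X a b \in F ->
  a \in X -> b \notin X -> c \in X -> c != a ->
  d \notin X -> d != b -> swap X c d \in F ->
  exists2 Q', Q' \in del F c & adj (swap X c d) Q' /\ adj Q' (swap X a b).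
Proof.
move=> exF YF aX bX cX ca dX db dF; set Y := swap X a b in YF *.
have ab : a != b by apply: contraNneq bX => <-.
have cb : c != b by apply: contraNneq bX => <-.
have cd : c != d by apply: contraNneq dX => <-.
have ad : a != d by apply: contraNneq dX => <-.
have bs : b \notin swap X c d by rewrite !inE; mem_cases.
have [|y yI yF] := exchange_dual (x := b) exF dF YF.
  by rewrite inE bs mem_swapr.
have ys : y \in swap X c d by case/setDP: yI.
have y_ad : y = d \/ y = a.
  move: yI; rewrite !inE; case: (y =P a); case: (y =P d); auto.
  by case: (y =P b); case: (y =P c); case: (y \in X).
exists (swap (swap X c d) y b).
  by rewrite mem_del yF !inE (negPf cb) (negPf cd) eqxx /= andbF.
split; first exact: adj_swap.
have cY : c \in Y by rewrite !inE ca cX orbT.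
rewrite adj_sym; apply/adjP; case: y_ad => ->; [exists c, a | exists c, d].
  by split=> //; [apply: mem_swapl | rewrite /Y; swap_eq].
by split=> //; [rewrite !inE; mem_cases | rewrite /Y; swap_eq].
Qed.

(** The property that is lost and regained along a path; it also holds when [P] has no neighbour in
    the deletion. *)
Definition settled F c U P := [forall V in del F c, adj P V ==> (V == U)].

Lemma settledP F c U P :
  reflect (forall V, V \in del F c -> adj P V -> V = U) (settled F c U P).
Proof.
apply: (iffP forall_inP) => H V VF; last by apply/implyP => /H->.
by move/(implyP (H V VF))/eqP.
Qed.

Lemma adj_del_swap F c P V : c \in P -> V \in del F c -> adj P V ->
  exists d, [/\ d \notin P, swap P c d \in F & V = swap P c d].
Proof.
rewrite mem_del => cP /andP[VF cV] /adjP[x [d [xP dP EV]]]; exists d.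
suff -> : c = x by rewrite -EV.
by apply: contraNeq cV => cx; rewrite EV !inE cx cP orbT.
Qed.

Lemma only_settled F c U P d : c \in P -> d \notin P -> only F P c d ->
  (swap P c d \in F -> swap P c d = U) -> settled F c U P.
Proof.
move=> cP dP /onlyP o eU; apply/settledP=> V VD /(adj_del_swap cP VD).
by case=> g [gP gF ->]; move: (gF); rewrite (o g) // => /eU.
Qed.

(** For a bad [c], this is the only possible neighbour without [c] of either end of the path. *)
Lemma bad_swap X a b c : a \in X -> b \notin X -> c \in X -> c != a ->
  swap (swap X a b) c a = swap X c b.
Proof.
move=> aX bX cX ca; have cb : c != b by apply: contraNneq bX => <-.
by swap_eq.
Qed.

(** If [c] can be replaced at [P] by an element other than [b], or at [Q] by one other than [a], a
    square gives an edge of the deletion whose ends bound the inserted path. Otherwise [P - c + b]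
    is the only possible neighbour of both there, so [P] and [Q] are settled or unsettled
    together. *)
Lemma unsettled_edge F c U P Q : exchange F ->
  P \in con F c -> Q \in con F c -> adj P Q ->
  settled F c U P != settled F c U Q ->
  exists P' Q' q, [/\ hampath (del F c) P' Q' q, adj P P' & adj Q' Q].
Proof.
rewrite !mem_con => exF /andP[PF cP] /andP[QF cQ] /adjP[a [b [aP bP EQ]]]; subst Q.
have ca : c != a by apply: contraTneq cQ => ->; apply: mem_swapl.
have cb : c != b by apply: contraNneq bP => <-.
set Q := swap P a b in QF cQ *.
have aQ : a \notin Q by apply: mem_swapl.
have bQ : b \in Q by apply: mem_swapr.
have PQ : swap Q b a = P by apply: swapK.
have inD R d : c \in R -> d \notin R -> swap R c d \in F -> swap R c d \in del F c.
  by move=> cR dR dF; rewrite mem_del dF mem_swapl.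
have exD := exchange_del (e := c) exF.
have [|/onlyPn[d [dP db dF]] _] := boolP (only F P c b); last first.
  have [Q' Q'D [a1 a2]] := square_del exF QF aP bP cP ca dP db dF.
  have [q hq] := hampath_exists exD (inD _ _ cP dP dF) Q'D a1.
  by exists (swap P c d), Q', q; split=> //; apply: adj_swap.
have [oQ oP|/onlyPn[d [dQ da dF]] _ _] := boolP (only F Q c a); last first.
  rewrite -PQ in PF.
  have [Q' Q'D [a1 a2]] := square_del exF PF bQ aQ cQ cb dQ da dF.
  rewrite adj_sym in a1; rewrite PQ adj_sym in a2.
  have [q hq] := hampath_exists exD Q'D (inD _ _ cQ dQ dF) a1.
  by exists Q', (swap Q c d), q; split=> //; rewrite adj_sym; apply: adj_swap.
have E1 : swap Q c a = swap P c b by apply: bad_swap.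
case/eqP; apply/idP/idP=> /settledP st.
  apply: (only_settled cQ aQ oQ); rewrite E1 => H; apply: st; last exact: adj_swap.
  exact: inD.
apply: (only_settled cP bP oP); rewrite -E1 => H; apply: st; last exact: adj_swap.
exact: inD.
Qed.

(** The filter recovers the old path and [find] the place of insertion, so insertions into different
    paths or at different places differ. *)
Lemma insertion F c X Y P' Q' p1 Q p2 q :
  hampath (con F c) X Y (p1 ++ Q :: p2) -> hampath (del F c) P' Q' q ->
  adj (last X p1) P' -> adj Q' Q -> exists D,
  [/\ hampath F X Y D, [seq B : {set E} <- D | c \in B] = p1 ++ Q :: p2 &
      find (fun B : {set E} => c \notin B) D = size p1].
Proof.
move=> hp hq a1 a2; exists (p1 ++ P' :: q ++ Q :: p2).
have sp := hampath_sub hp; have mq := mem_hampath hq.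
split; first exact: hampath_insert hp hq a1 a2.
  rewrite -cat_cons !filter_cat (_ : filter _ (P' :: q) = [::]).
    rewrite -filter_cat; apply/all_filterP/allP=> B /sp.
    by rewrite mem_con => /andP[].
  apply/eqP; rewrite -size_eq0 size_filter -leqn0 leqNgt -has_count.
  by apply/hasPn=> B; rewrite mq mem_del => /andP[].
rewrite find_cat /= ifN; last first.
  apply/hasPn=> B Bp; have := sp B; rewrite mem_cat Bp mem_con.
  by move=> /(_ isT)/andP[_ ->].
have := mq P'; rewrite mem_head mem_del => /esym/andP[_ ->].
by rewrite addn0.
Qed.

Lemma split_first (T : Type) (a : pred T) s : has a s ->
  exists s1 x s2, [/\ s = s1 ++ x :: s2, a x & all (predC a) s1].
Proof.
elim: s => //= x s IH; case ax: (a x) => /=; first by exists [::], x, s.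
by case/IH=> s1 [y [s2 [-> ay al]]]; exists (x :: s1), y, s2; rewrite /= ax.
Qed.

Lemma two_insertions F X a b c p : exchange F -> X \in F ->
  a \in X -> b \notin X -> c \in X -> c != a -> c \notin coloops F ->
  bad F X a b c -> hampath (con F c) X (swap X a b) p -> 1 < size p ->
  exists D1 D2, [/\ D1 != D2, hampath F X (swap X a b) D1,
    hampath F X (swap X a b) D2,
    [seq B : {set E} <- D1 | c \in B] = p &
    [seq B : {set E} <- D2 | c \in B] = p].
Proof.
move=> exF XF aX bX cX ca ncl /andP[oX oY] hp sp.
set Y := swap X a b in oY hp *; pose U := swap X c b.
have cb : c != b by apply: contraNneq bX => <-.
have cY : c \in Y by rewrite !inE ca cX orbT.
have aY : a \notin Y by apply: mem_swapl.
have mp := mem_hampath hp.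
suff: exists p1 P1 p2 q1 P2 p3, [/\ p = p1 ++ P1 :: p2, p = q1 ++ P2 :: p3,
    size p1 != size q1,
    exists P' Q' q, [/\ hampath (del F c) P' Q' q, adj (last X p1) P' & adj Q' P1] &
    exists P' Q' q, [/\ hampath (del F c) P' Q' q, adj (last X q1) P' & adj Q' P2]].
  case=> p1 [P1 [p2 [q1 [P2 [p3 [E1 E2 ne [R1 [S1 [r1 [h1 a1 b1]]]]
    [R2 [S2 [r2 [h2 a2 b2]]]]]]]]]].
  have h := hp; rewrite E1 in h; have [D1 [H1 F1 f1]] := insertion h h1 a1 b1.
  have h' := hp; rewrite E2 in h'; have [D2 [H2 F2 f2]] := insertion h' h2 a2 b2.
  exists D1, D2; split=> //; [|by rewrite F1 E1|by rewrite F2 E2].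
  by apply: contraNneq ne => D12; rewrite -f1 -f2 D12.
(* If the deletion has one basis [U], every basis of the path is adjacent to it, as [c] is no
   coloop; so [U] fits into each of the first two edges. *)
have [DU|DU] := eqVneq (del F c) [set U].
  have aU B : B \in X :: p -> adj B U.
    rewrite mp mem_con => /andP[BF cB].
    have [d dB dF] := noncoloop_swap exF BF cB ncl.
    have : swap B c d \in del F c by rewrite mem_del dF mem_swapl.
    by rewrite DU => /set1P<-; apply: adj_swap.
  case: p sp aU {hp mp} => [|P1 [|P2 p]] // _ aU.
  exists [::], P1, (P2 :: p), [:: P1], P2, p; split=> //; exists U, U, [::];
    by split; rewrite ?hampath1 // 1?[adj U _]adj_sym; apply: aU; rewrite !inE eqxx ?orbT.
have stX : settled F c U X by apply: only_settled oX _.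
have stY : settled F c U Y.
  by apply: only_settled oY _; rewrite // /Y bad_swap.
have [V VD VU] : exists2 V, V \in del F c & V != U.
  apply/exists_inP; apply: contraR DU => /exists_inPn H.
  have [B BF cB] := coloops_avoid ncl.
  have BD : B \in del F c by rewrite mem_del BF.
  have eU W : W \in del F c -> W = U by move=> /H; rewrite negbK => /eqP.
  apply/eqP/setP=> W; rewrite in_set1; apply/idP/eqP => [/eU//|->].
  by rewrite -(eU B).
(* Bringing [c] into [V] by a dual exchange with [X] gives a neighbour of [V] on the path; it is
   unsettled because [V] differs from [U]. *)
have [P Pp nP] : exists2 P, P \in X :: p & ~~ settled F c U P.
  have := VD; rewrite mem_del => /andP[VF cV].
  have [|y] := exchange_dual (x := c) exF VF XF; first by rewrite inE cV cX.
  rewrite inE => /andP[yX yV] yF; exists (swap V y c).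
    by rewrite mp mem_con yF mem_swapr.
  apply: contra VU => /settledP/(_ V VD)->//.
  by rewrite adj_sym; apply: adj_swap.
(* [Q] is the first unsettled basis and [R] below the first settled one after it, which exists
   because [Y] is settled. Both are entered along an edge where the property changes. *)
have /split_first[p1 [Q [p2 [Ep nQ al1]]]] : has (fun B => ~~ settled F c U B) p.
  apply/hasP; exists P => //; move: Pp; rewrite inE => /orP[/eqP PX|//].
  by rewrite PX stX in nP.
have lY : last Q p2 = Y.
  by case/and4P: hp => _ /eqP; rewrite Ep last_cat.
have /split_first[p3 [R [p4 [Ep2 stR al2]]]] : has (settled F c U) p2.
  apply/hasP; exists Y => //; move: lY nQ; case: (lastP p2) => [/= ->|s z].
    by rewrite stY.
  by rewrite last_rcons => -> _; rewrite mem_rcons mem_head.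
have stl : settled F c U (last X p1).
  have := mem_last X p1; rewrite in_cons => /orP[/eqP->//|/(allP al1)].
  by rewrite inE negbK.
have nstl : ~~ settled F c U (last Q p3).
  by have := mem_last Q p3; rewrite in_cons => /orP[/eqP->|/(allP al2)].
have pth : path adj X p by case/and4P: hp.
have E2 : p = (p1 ++ Q :: p3) ++ R :: p4 by rewrite Ep Ep2 -catA.
exists p1, Q, p2, (p1 ++ Q :: p3), R, p4; split=> //.
- by rewrite size_cat /= addnS -addSn -[X in X != _]addn0 neq_ltn ltn_addr // addn0.
- move: pth; rewrite Ep cat_path /= => /and3P[_ aPQ _].
  apply: (unsettled_edge (U := U)) aPQ _ => //; last by rewrite stl (negPf nQ).
    by rewrite -mp Ep -cat_cons mem_cat mem_last.
  by rewrite -mp Ep inE mem_cat mem_head !orbT.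
- move: pth; rewrite E2 cat_path /= => /and3P[_ aPQ _].
  apply: (unsettled_edge (U := U)) aPQ _ => //; last first.
  + by rewrite last_cat /= stR (negPf nstl).
  + by rewrite -mp E2 inE mem_cat mem_head !orbT.
  by rewrite -mp E2 -cat_cons mem_cat mem_last.
Qed.

(** * Counting Hamiltonian paths *)

Lemma double_preimages (T : eqType) (r : T -> T) (P Q : pred T) (s : seq T) :
  uniq s -> all P s ->
  (forall x, P x -> exists y z, [/\ y != z, Q y, Q z, r y = x & r z = x]) ->
  exists s', [/\ uniq s', size s' = 2 * size s, all Q s' &
                 {subset map r s' <= s}].
Proof.
move=> us Ps H; elim: s us Ps => [|x s IH] /=; first by exists [::].
case/andP=> xs us /andP[Px Ps].
have [s' [us' ss' Qs' sub]] := IH us Ps.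
have [y [z [yz Qy Qz ry rz]]] := H x Px.
(* The inclusion of images carried through the induction separates new preimages from old ones: the
   old ones map into [s], which lacks [x]. *)
have nin w : r w = x -> w \notin s'.
  move=> rw; apply: contra xs => ws; rewrite -rw; apply: sub; exact: map_f.
exists [:: y, z & s']; split=> /=.
- by rewrite inE negb_or yz !nin.
- by rewrite ss' mulnS.
- by rewrite Qy Qz.
- by move=> w; rewrite !inE ry rz orbA orbb => /orP[->//|/sub->]; rewrite orbT.
Qed.

(** The only possible new coloop is [e], which is [c] or lies outside [S]; hence at most [c] is lost
    from the count. *)
Lemma card_noncoloops_con F X (S : {set E}) e c n : exchange F -> X \in F ->
  e \in X -> (e == c) || (e \notin S) -> n < #|S :\: coloops F| ->
  n <= #|(S :\ c) :\: coloops (con F e)|.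
Proof.
move=> exF XF eX ecS lt; rewrite -ltnS; apply: leq_trans lt _.
rewrite -[X in _ <= X]add1n -(cards1 c); apply: leq_trans _ (leq_card_setU _ _).
apply/subset_leq_card/subsetP=> z; rewrite !inE => /andP[zc zS].
case: (z =P c) => //= nzc; rewrite zS andbT; apply: contra zc => zc.
have := subsetP (coloops_con exF XF eX) z zc; rewrite !inE => /orP[/eqP ze|//].
by move: ecS; rewrite -ze zS orbF => /eqP.
Qed.

Lemma many_hampaths n F X Y : exchange F -> X \in F -> Y \in F -> adj X Y ->
  n <= #|(X :&: Y) :\: coloops F| ->
  exists s, [/\ uniq s, 2 ^ n.-1 <= size s & all (hampath F X Y) s].
Proof.
have one F' X' Y' : exchange F' -> X' \in F' -> Y' \in F' -> adj X' Y' ->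
    exists s, [/\ uniq s, 1 <= size s & all (hampath F' X' Y') s].
  move=> exF XF YF aXY; have [p hp] := hampath_exists exF XF YF aXY.
  by exists [:: p]; rewrite /= hp.
(* As [n.-1] is 0 both for 0 and for 1, a single path suffices in both base cases. *)
elim: n F X Y => [|[|n] IH] F X Y exF XF YF aXY; [by move=> _; apply: one..|].
have /adjP[a [b [aX bX EY]]] := aXY; subst Y.
rewrite setI_swap // => lt.
have [/exists_inP[c cI bd]|] := boolP [exists c in (X :\ a) :\: coloops F, bad F X a b c].
  have /setDP[/setD1P[ca cX] ncl] := cI.
  have cY : c \in swap X a b by rewrite !inE ca cX orbT.
  have le1 : n.+1 <= #|(X :\ a) :\: coloops (con F c)|.
    have le2 := card_noncoloops_con exF XF cX (introT orP (or_introl (eqxx c))) lt.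
    by apply: leq_trans le2 _; apply/subset_leq_card/setSD/subsetDl.
  have XC : X \in con F c by rewrite mem_con XF.
  have YC : swap X a b \in con F c by rewrite mem_con YF.
  have exC := exchange_con (e := c) exF.
  have [|s [us ss hs]] := IH _ _ _ exC XC YC aXY; first by rewrite setI_swap.
  have [|s' [us' ss' hs' _]] := double_preimages
      (r := fun D : seq {set E} => [seq B : {set E} <- D | c \in B])
      (Q := hampath F X (swap X a b)) us hs.
    move=> p hp; apply: two_insertions => //.
    (* Some basis of the contraction avoids a further common noncoloop [c'], so it is neither end of
       the path; hence [p] has at least two entries. *)
    have [c'] : exists c', c' \in (X :\ a) :\: coloops (con F c).
      by apply/set0Pn; rewrite -card_gt0; apply: leq_trans le1.
    rewrite 3!inE => /and3P[c'C c'a c'X].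
    have [B BC c'B] := coloops_avoid c'C.
    have := mem_hampath hp B; rewrite BC inE.
    case/orP=> [/eqP BX|]; first by rewrite BX c'X in c'B.
    case/and4P: hp => _ /eqP; case: p => [|P1 [|P2 p]] //= -> _ _.
    by rewrite inE => /eqP BY; rewrite BY !inE c'a c'X orbT in c'B.
  exists s'; split=> //; rewrite ss' expnS; by rewrite leq_pmul2l.
move/exists_inPn=> nbad.
have exC := exchange_con (e := a) exF; have exD := exchange_del (e := a) exF.
have XC : X \in con F a by rewrite mem_con XF.
have YD : swap X a b \in del F a by rewrite mem_del YF mem_swapl.
have half c : c \in (X :\ a) :\: coloops F -> exists d Y1 q s,
    [/\ d \notin X, adj (swap X c d) Y1, hampath (del F a) Y1 (swap X a b) q,
        uniq s /\ 2 ^ n <= size s &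
        all (hampath (con F a) X (swap X c d)) s].
  move=> cI; have /setDP[/setD1P[ca cX] ncl] := cI.
  have [d [Y1 [dX X1C Y1D a1 a2]]] := square exF XF YF aX bX cX ca (nbad c cI).
  have [q hq] := hampath_exists exD Y1D YD a2.
  have [|s [us ss hs]] := IH _ _ _ exC XC X1C (adj_swap cX dX).
    have aXa : (a == c) || (a \notin X :\ a) by rewrite !inE eqxx orbT.
    apply: leq_trans (card_noncoloops_con exF XF aX aXa lt) _.
    apply/subset_leq_card/subsetP=> z; rewrite !inE.
    by case/and4P=> -> -> _ ->; rewrite orbT.
  by exists d, Y1, q, s.
have [c1 c1I] : exists c1, c1 \in (X :\ a) :\: coloops F.
  by apply/set0Pn; rewrite -card_gt0; apply: leq_trans lt.
have [c2] : exists c2, c2 \in ((X :\ a) :\: coloops F) :\ c1.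
  by apply/set0Pn; rewrite -card_gt0; move: lt; rewrite (cardsD1 c1) c1I ltnS; apply: leq_trans.
case/setD1P=> c21 c2I.
have [d1 [Y1 [q1 [s1 [d1X a1 hq1 [us1 ss1] hs1]]]]] := half c1 c1I.
have [d2 [Y2 [q2 [s2 [d2X a2 hq2 [us2 ss2] hs2]]]]] := half c2 c2I.
have c1X : c1 \in X by case/setDP: c1I => /setD1P[].
have c2X : c2 \in X by case/setDP: c2I => /setD1P[].
have inj s X1 Y' q : all (hampath (con F a) X X1) s ->
    hampath (del F a) Y' (swap X a b) q -> {in s &, injective (fun p => p ++ Y' :: q)}.
  move=> hs hq p p' /(allP hs) hp /(allP hs) hp' E1.
  by rewrite -(filter_hampath_cat hp hq) E1 (filter_hampath_cat hp' hq).
exists ([seq p ++ Y1 :: q1 | p <- s1] ++ [seq p ++ Y2 :: q2 | p <- s2]); split.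
- rewrite cat_uniq !map_inj_in_uniq ?us1 ?us2 ?andbT /=;
    try exact: inj hs1 hq1; try exact: inj hs2 hq2.
  apply/hasPn=> _ /mapP[p2 p2s ->]; apply/mapP=> -[p1 p1s E12].
  have hp1 := allP hs1 _ p1s; have hp2 := allP hs2 _ p2s.
  (* A path in both families would have equal initial parts, hence equal ends [X - c1 + d1] and
     [X - c2 + d2]; but only the second contains [c1]. *)
  have Ep : p2 = p1.
    by rewrite -(filter_hampath_cat hp2 hq2) E12 (filter_hampath_cat hp1 hq1).
  move: hp1 hp2; rewrite Ep => /and4P[_ /eqP El _ _] /and4P[_ /eqP].
  rewrite El => Es _ _.
  have := mem_swapl c1X d1X; rewrite Es !inE [c1 == c2]eq_sym (negPf c21) c1X /=.
  by rewrite orbT.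
- by rewrite size_cat !size_map expnS mul2n -addnn leq_add.
- rewrite all_cat; apply/andP; split; apply/allP=> _ /mapP[p ps ->].
    exact: hampath_cat (allP hs1 _ ps) hq1 a1.
  exact: hampath_cat (allP hs2 _ ps) hq2 a2.
Qed.

End SetFamilies.

(** * From Hamiltonian paths to Hamiltonian cycles *)

Section HamiltonianCycles.
Variables (H : graph) (ed : vertex H -> vertex H -> edge H).
Variable r : rel (vertex H).
Hypothesis ends_ed : forall x y, r x y -> ends (ed x y) = [set x; y].
Implicit Types (x y z : vertex H) (p : seq (vertex H)).

(** Unordered pairs, because Hamiltonian cycles are counted as edge sets, without direction. *)
Definition links x p := pairmap (fun y z => [set y; z]) x p.

(** The vertex [z], to which the tour finally goes, is kept apart from [x], which advances in the
    recursion. *)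
Fixpoint tour z x p : seq (vertex H * edge H) :=
  if p is y :: p' then (x, ed x y) :: tour z y p' else [:: (x, ed x z)].

Lemma links_sub x p S : S \in links x p -> {subset S <= x :: p}.
Proof.
elim: p x => //= y p IH x; rewrite inE => /orP[/eqP->|/IH sS] z.
  by rewrite !inE orbA => ->.
by move/sS; rewrite [in X in _ -> X]inE orbC => ->.
Qed.

Lemma links_head x y p : x \notin y :: p -> [set x; y] \notin links y p.
Proof. by apply: contra => /links_sub; apply; rewrite set21. Qed.

Lemma links_uniq x p : uniq (x :: p) -> uniq (links x p).
Proof.
elim: p x => //= y p IH x /andP[xp up].
by rewrite (links_head xp) (IH y up).
Qed.

(** As [x] is not repeated, only the first link contains it; this determines the next vertex, and
    induction does the rest. *)
Lemma links_inj x p p' : uniq (x :: p) -> uniq (x :: p') ->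
  links x p =i links x p' -> p = p'.
Proof.
elim: p x p' => [|y p IH] x [|y' p'] //=.
- by move=> _ _ /(_ [set x; y']); rewrite !inE eqxx.
- by move=> _ _ /(_ [set x; y]); rewrite !inE eqxx.
move=> /andP[xp up] /andP[xp' up'] El.
have Ey : y = y'.
  have := El [set x; y]; rewrite inE eqxx inE => /esym/orP[/eqP|/links_sub/(_ x)].
    by case/set2_inj=> [[]|[E1 E2]] //; rewrite E2 -E1.
  by rewrite set21 (negPf xp') => /(_ isT).
rewrite -{}Ey in xp' up' El *; congr (_ :: _); apply: (IH y) => // S.
have [->|nS] := eqVneq S [set x; y].
  by rewrite (negPf (links_head xp)) (negPf (links_head xp')).
by have := El S; rewrite !inE (negPf nS).
Qed.

(** With at least three vertices, the closing pair differs from the first link in its end other than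
    [x], and no later link contains [x]. *)
Lemma links_close x p : uniq (x :: p) -> 1 < size p ->
  [set last x p; x] \notin links x p.
Proof.
case: p => // y p /andP[xp yp]; case: p => // z p in xp yp * => _.
rewrite (_ : links x _ = [set x; y] :: links y (z :: p)) // inE negb_or; apply/andP; split.
  have lp : last z p \in z :: p := mem_last z p.
  apply/negP=> /eqP/set2_inj[[_ E1]|[E1 _]].
    by rewrite E1 mem_head in xp.
  by case/andP: yp; rewrite -E1 lp.
by apply: contra xp => /links_sub; apply; rewrite set22.
Qed.

Lemma tour_vertices z x p : unzip1 (tour z x p) = x :: p.
Proof. by elim: p x => //= y p IH x; rewrite IH. Qed.

Lemma tour_links z x p : path r x p -> r (last x p) z ->
  map (@ends H) (unzip2 (tour z x p)) = rcons (links x p) [set last x p; z].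
Proof.
elim: p x => [|y p IH] x /= => [_ rz|/andP[rxy py] rz]; first by rewrite ends_ed.
by rewrite ends_ed // IH.
Qed.

Lemma tour_path z x p q0 q1 : path r x p -> r (last x p) z ->
  ends q0.2 = [set q0.1; x] -> q1.1 = z ->
  path (@step H) q0 (rcons (tour z x p) q1).
Proof.
move=> + + + Ez; rewrite -{}Ez; elim: p x q0 => [|y p IH] x q0 /=.
  by move=> _ rz E0; rewrite /step /= E0 ends_ed ?eqxx.
by move=> /andP[rxy py] rz E0; rewrite {1}/step E0 eqxx; apply: IH; rewrite //= ends_ed.
Qed.

Lemma mem_tour_last z x p : ed (last x p) z \in unzip2 (tour z x p).
Proof. by elim: p x => [|y p IH] x /=; rewrite inE ?IH ?orbT. Qed.

Lemma tour_hamiltonian x p : path r x p -> r (last x p) x -> uniq (x :: p) ->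
  1 < size p -> x :: p =i predT -> is_hamiltonian_cycle (tour x x p).
Proof.
move=> pp rl up sp al; apply/andP; split; last first.
  by apply/forallP=> y; rewrite tour_vertices al.
apply/and4P; split.
- by case: p {pp rl up sp al}.
- case: p sp pp rl {up al} => // y p _ /= /andP[rxy py] rl.
  by apply: tour_path; rewrite //= ends_ed.
- by rewrite tour_vertices.
(* Edges with different sets of ends are different, so it is enough to compare links. *)
- apply: (@map_uniq _ _ (@ends H)); rewrite tour_links // rcons_uniq.
  by rewrite links_close // links_uniq.
Qed.

Lemma card_hamiltonian_cycles x y (s : seq (seq (vertex H))) : r y x -> uniq s ->
  (forall p, p \in s ->
     [/\ path r x p, last x p = y, uniq (x :: p), 1 < size p & x :: p =i predT]) ->
  size s <= #|[set C in hamiltonian_cycles H | ed y x \in C]|.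
Proof.
move=> ryx us hs; pose C p := [set e in unzip2 (tour x x p)].
have injC : {in s &, injective C}.
  move=> p p' /hs[pp lp up sp _] /hs[pp' lp' up' sp' _] EC.
  apply: (links_inj up up') => S.
  have : map (@ends H) (unzip2 (tour x x p)) =i map (@ends H) (unzip2 (tour x x p')).
    by apply: eq_mem_map => e; have := congr1 (fun A : {set _} => e \in A) EC; rewrite /C !inE.
  move/(_ S); rewrite !tour_links ?lp ?lp' // !mem_rcons !inE.
  have := links_close up sp; have := links_close up' sp'; rewrite lp lp'.
  by case: eqVneq => [-> /negPf-> /negPf->|].
rewrite -(size_map C); have /card_uniqP<- : uniq (map C s) by rewrite map_inj_in_uniq.
apply/subset_leq_card/subsetP=> _ /mapP[p /hs[pp lp up sp al] ->].
rewrite inE; apply/andP; split.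
  by apply/hamiltonian_cyclesP; exists (tour x x p); rewrite ?tour_hamiltonian // lp.
by rewrite inE -lp mem_tour_last.
Qed.

End HamiltonianCycles.

(** * Hamiltonian cycles of the basis graph of a matroid *)

Section BasisGraphCycles.
Variables (E : finType) (M : matroid E).

Lemma card_symdiff_swap (X : {set E}) c d :
  c \in X -> d \notin X -> #|symdiff X (swap X c d)| = 2.
Proof.
move=> cX dX; have cd : c != d by apply: contraNneq dX => <-.
have -> : symdiff X (swap X c d) = [set c; d].
  apply/setP=> z; rewrite !inE; case: (z =P c) => [->|_].
    by rewrite cX (negPf cd).
  case: (z =P d) => [->|_]; first by rewrite (negPf dX).
  by case: (z \in X).
by rewrite cards2 cd.
Qed.

Lemma adj_basis_adjacent (B B' : basis M) : basis_adjacent B B' = adj (val B) (val B').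
Proof.
apply/eqP/idP => [|/adjP[c [d [cB dB E']]]]; last by rewrite E' card_symdiff_swap.
exact: adj_symdiff (@bases_exchange _ M) (valP B) (valP B').
Qed.

Lemma basis_graph_cycles (e : edge (basis_graph M)) (B B' : basis M) n :
  val e = [set B; B'] -> basis_adjacent B B' ->
  0 < n <= #|(val B :&: val B') :\: coloops (bases M)| ->
  2 ^ n.-1 <= #|[set C in hamiltonian_cycles (basis_graph M) | e \in C]|.
Proof.
move=> Ee; rewrite adj_basis_adjacent => aB /andP[n_gt0 le].
have exM : exchange (bases M) by apply: bases_exchange.
have [s [us ss hs]] := many_hampaths exM (valP B) (valP B') aB le.
pose r : rel (basis M) := relpre val (@adj E).
(* The default [e] is taken only when [x] and [y] are not adjacent. *)
pose ed (x y : basis M) : basis_edge M := insubd e [set x; y].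
have ends_ed (x y : basis M) : r x y -> val (ed x y) = [set x; y].
  move=> rxy; rewrite insubdK // unfold_in.
  by apply/existsP; exists x; apply/existsP; exists y; rewrite adj_basis_adjacent eqxx andbT.
have -> : e = ed B' B by apply: val_inj; rewrite ends_ed 1?setUC // /r /= adj_sym.
pose f : seq {set E} -> seq (basis M) := map (insubd B).
have fK (p : seq {set E}) : {subset p <= bases M} -> map val (f p) = p.
  move=> sp; rewrite -map_comp -[RHS]map_id; apply/eq_in_map=> X /sp XM /=.
  by rewrite insubdK.
have sub p : p \in s -> {subset p <= bases M} by move=> /(allP hs) /hampath_sub.
apply: leq_trans ss _; rewrite -(size_map f).
apply: (@card_hamiltonian_cycles (basis_graph M) ed r ends_ed B B') => //.
- by rewrite /r /= adj_sym.
- rewrite map_inj_in_uniq // => p p' ps ps' /(congr1 (map val)).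
  by rewrite !fK //; apply: sub.
move=> _ /mapP[p ps ->]; have hp := allP hs _ ps; have mp := mem_hampath hp.
have Ef := fK _ (sub _ ps).
have /and4P[pp /eqP lp up _] := hp; split.
- by rewrite -Ef path_map in pp.
- by apply: val_inj; rewrite -last_map Ef.
- by rewrite -Ef -map_cons map_inj_uniq // in up; apply: val_inj.
(* A basis avoiding a common noncoloop is neither [B] nor [B'], so the path has a third vertex. *)
- rewrite size_map; have [c] : exists c, c \in (val B :&: val B') :\: coloops (bases M).
    by apply/set0Pn; rewrite -card_gt0; apply: leq_trans le.
  rewrite 2!inE => /and3P[ncl cB cB'].
  have [X XM cX] := coloops_avoid ncl.
  have := mp X; rewrite XM inE => /orP[/eqP EX|]; first by rewrite EX cB in cX.
  case: p lp {ps hp mp Ef pp up} => [|P1 [|P2 p]] //= ->; rewrite inE => /eqP EX.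
  by rewrite EX cB' in cX.
- by move=> x; rewrite -(mem_map val_inj) map_cons Ef mp (valP x).
Qed.

End BasisGraphCycles.

(** * Cycle matroids *)

(** A connected subset of [A] with fewest edges is acyclic: an edge whose ends stay joined without
    it could be deleted. *)
Lemma spanning_tree_sub (G : graph) (A : {set edge G}) : connected A ->
  exists2 T, T \in spanning_trees G & T \subset A.
Proof.
move=> cA; pose P (B : {set edge G}) := connected B && (B \subset A).
have PA : P A by rewrite /P cA subxx.
case: (@arg_minnP _ A P (fun B => #|B|) PA) => T /andP[cT sT] minT.
exists T => //; rewrite inE cT; apply/acyclic_bridgeP=> e x y eT Ee; apply/negP=> cxy.
have /minT : P (T :\ e).
  rewrite /P (subset_trans (subsetDl _ _) sT) andbT.
  apply/forallP=> u; apply/forallP=> v; have /forallP/(_ u)/forallP/(_ v) := cT.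
  case/(connect_del Ee) => [//|[c d]|[c d]].
    exact: connect_trans (connect_trans c cxy) d.
  by apply: connect_trans d; apply: connect_trans c _; rewrite connectC.
by rewrite leqNgt (cardsD1 e T) eT ltnS leqnn.
Qed.

(* Grow a tree vertex by vertex: an edge leaving S is not among those inside S. *)
Lemma leq_card_connected (G : graph) (A : {set edge G}) :
  connected A -> #|vertex G|.-1 <= #|A|.
Proof.
move=> cA; case: (posnP #|vertex G|) => [->//|/card_gt0P[x0 _]].
have H k : k < #|vertex G| -> exists (S : {set vertex G}) (B : {set edge G}),
    [/\ x0 \in S, #|S| = k.+1, #|B| = k, B \subset A &
        forall e, e \in B -> ends e \subset S].
  elim: k => [_|k IH lt].
    exists [set x0], set0; rewrite set11 cards1 cards0 sub0set.
    by split=> // e; rewrite inE.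
  have [S [B [x0S cS cB sB eB]]] := IH (ltnW lt).
  have [y yS] : exists y, y \in ~: S.
    by apply/set0Pn; rewrite -card_gt0 cardsCs setCK subn_gt0 cS.
  rewrite inE in yS; have cxy := forallP (forallP cA x0) y.
  have [f [u [v [fA Ef uS vS]]]] := connect_cross cxy x0S yS.
  exists (v |: S), (f |: B); split.
  - by rewrite inE x0S orbT.
  - by rewrite cardsU1 vS cS.
  - rewrite cardsU1 cB; case: (boolP (f \in B)) => // /eB /subsetP/(_ v).
    by rewrite Ef set22 (negPf vS) => /(_ isT).
  - by rewrite subUset sub1set fA.
  - move=> e; rewrite inE => /orP[/set1P->|/eB/subset_trans]; last by apply; apply: subsetUr.
    by rewrite Ef subUset !sub1set !inE eqxx uS orbT.
case nG: #|vertex G| => [|k] //=.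
have [|S [B [_ _ <- sB _]]] := H k; first by rewrite nG.
exact: subset_leq_card.
Qed.

(** Without any one edge the graph stays connected, so some spanning tree avoids that edge. *)
Lemma coloops_spanning_trees (G : graph) :
  edge_connected G 2 -> coloops (spanning_trees G) = set0.
Proof.
case/andP=> _ /forallP c2; apply/setP=> e; rewrite inE; apply/negbTE/bigcapP=> H.
have /implyP := c2 [set e]; rewrite cards1 => /(_ isT) /spanning_tree_sub[T TS sT].
by have /(subsetP sT) := H T TS; rewrite !inE eqxx.
Qed.

Theorem theorem2p13 (G : graph) (n : nat) (order_G : #|vertex G| = n)
    (n_ge3 : 3 <= n) (conn2 : edge_connected G 2)
    (e : edge (basis_graph (cycle_matroid (edge_connectedS conn2)))) :
  2 ^ (n - 3) <=
    #|[set C in hamiltonian_cycles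
                  (basis_graph (cycle_matroid (edge_connectedS conn2)))
       | e \in C]|.
Proof.
have /existsP[B /existsP[B' /andP[aB /eqP Ee]]] := valP e.
(* The two trees share at least [n - 2] edges, none of them a coloop: each tree has at least [n - 1]
   edges and exactly one is exchanged. *)
rewrite (_ : n - 3 = (n - 2).-1); last by rewrite -subn1 -subnDA.
apply: (basis_graph_cycles Ee aB); move: aB.
rewrite subn_gt0 n_ge3 coloops_spanning_trees // setD0.
rewrite adj_basis_adjacent => /adjP[a [b [aX bX ->]]].
have : connected (val B) by have := valP B; rewrite inE => /andP[].
move/leq_card_connected; rewrite order_G (cardsD1 a) aX => le.
by rewrite setI_swap // leq_subLR; case: n n_ge3 le {order_G}.
Qed.
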